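(* Let $X$ be a complex Banach space, $\tau>0$, $T=(N+1)\tau$ for a fixed $N\in\mathbb{N}_{0}$, and let $A_{0},A_{1}\in\mathcal{L}(X)$ have zero commutator $A_{0}A_{1}-A_{1}A_{0}=0$. Then the fundamental solution $\mathcal{S}(\cdot;\tau):[-\tau,T]\to\mathcal{L}(X)$ of $\frac{\mathrm{d}}{\mathrm{d}t}u(t)=A_{0}u(t)+A_{1}u(t-\tau)$, satisfying $\mathcal{S}(t;\tau)=\Theta$ for $-\tau\le t<0$ and $\mathcal{S}(0;\tau)=I$, can be expressed, for every $n\in\{0,1,\dots,N\}$ and $n\tau<t\le(n+1)\tau$, by $$\mathcal{S}(t;\tau)=\exp(A_{0}t)\exp_{\tau}(A_{2}t)=\exp_{\tau}(A_{2}t)\exp(A_{0}t),\qquad A_{2}:=A_{1}\exp(-A_{0}\tau)\in\mathcal{L}(X).$$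
   Context: $\mathbb{N}_0=\mathbb{N}\cup\{0\}$; $I$ and $\Theta$ are the identity and zero operators. For $B\in\mathcal{L}(X)$ the pure delayed operator-valued exponential is defined by $\exp_{\tau}(Bt)=\Theta$ for $-\tau\le t<0$, $\exp_{\tau}(B\cdot 0)=I$, and $\exp_{\tau}(Bt)=\sum_{l=0}^{n}B^{l}\frac{(t-l\tau)^{l}}{l!}$ for $n\tau<t\le(n+1)\tau$, $n\in\mathbb{N}_{0}$. The fundamental solution is the operator family satisfying $\frac{\mathrm{d}}{\mathrm{d}t}\mathcal{S}(t;\tau)=A_{0}\mathcal{S}(t;\tau)+A_{1}\mathcal{S}(t-\tau;\tau)$ for $t\ge 0$ with the stated initial conditions; it is given explicitly by $\mathcal{S}(t;\tau)=\sum_{l=0}^{n}S_{l}(t,l\tau)$ for $n\tau<t\le(n+1)\tau$, where $S_{0}(t,0)=\exp(A_{0}t)$ and $S_{l}(t,l\tau)=\int_{l\tau}^{t}\exp(A_{0}(t-s))A_{1}S_{l-1}(s-\tau,(l-1)\tau)\,\mathrm{d}s$ for $t\ge l\tau$, $l\in\mathbb{N}$. *)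

(* Defs.v *)
From HB Require Import structures.
From mathcomp Require Import all_boot all_order all_algebra.
From mathcomp Require Import complex.
From mathcomp Require Import boolp classical_sets functions reals.
From mathcomp Require Import topology normedtype sequences.

Set Implicit Arguments.
Unset Strict Implicit.
Unset Printing Implicit Defensive.

Import Order.TTheory GRing.Theory Num.Theory.
Import numFieldNormedType.Exports.

Local Open Scope classical_set_scope.
Local Open Scope ring_scope.
Local Open Scope complex_scope.

Section BoundedOperators.
Variables (R : realType) (X : normedModType R[i]).

Definition bounded_linear : {pred X -> X} :=
  [pred f : X -> X | `[< linear f /\ continuous f >]].

Record bounded_op := BoundedOp {
  op_fun :> X -> X;
  op_funP : op_fun \in bounded_linear
}.

HB.instance Definition _ := [isSub for op_fun].
HB.instance Definition _ := gen_eqMixin bounded_op.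
HB.instance Definition _ := gen_choiceMixin bounded_op.

Lemma op_linear (A : bounded_op) : linear A.
Proof. by case: A => f /= /asboolP[]. Qed.

Lemma op_continuous (A : bounded_op) : continuous A.
Proof. by case: A => f /= /asboolP[]. Qed.

Lemma op_ext (A B : bounded_op) : (forall x, A x = B x) -> A = B.
Proof. by move=> AB; apply/val_inj/funext. Qed.

HB.instance Definition _ (A : bounded_op) :=
  GRing.isLinear.Build R[i] X X *:%R A (op_linear A).

Lemma bounded_linear_submod : submod_closed bounded_linear.
Proof.
split=> [|a f g /asboolP[lf cf] /asboolP[lg cg]]; apply/asboolP; split.
- by move=> a u v /=; rewrite /GRing.zero /= scaler0 addr0.
- by move=> x; exact: cvg_cst.
- move=> b u v.
  change (a *: f (b *: u + v) + g (b *: u + v) =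
          b *: (a *: f u + g u) + (a *: f v + g v)).
  by rewrite lf lg !scalerDr !scalerA (mulrC b a) addrACA.
- move=> x; apply: cvgD; last exact: cg.
  by apply: cvgZl_tmp; exact: cf.
Qed.

HB.instance Definition _ :=
  GRing.SubChoice_isSubLmodule.Build R[i] (X -> X) bounded_linear bounded_op
    bounded_linear_submod.

Lemma bounded_linear_id : (id : X -> X) \in bounded_linear.
Proof. by apply/asboolP; split=> // x; exact: cvg_id. Qed.

Lemma bounded_linear_comp (A B : bounded_op) : (A \o B) \in bounded_linear.
Proof.
apply/asboolP; split=> [a u v /=|x]; first by rewrite !linearP.
by apply: continuous_comp; exact: op_continuous.
Qed.

Definition op_id := BoundedOp bounded_linear_id.
Definition op_comp (A B : bounded_op) := BoundedOp (bounded_linear_comp A B).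

Lemma op_addE (A B : bounded_op) x : (A + B) x = A x + B x.
Proof. by []. Qed.

Lemma op_scaleE (a : R[i]) (A : bounded_op) x : (a *: A) x = a *: A x.
Proof. by []. Qed.

Lemma op_zeroE x : (0 : bounded_op) x = 0.
Proof. by []. Qed.

Fact op_compA : associative op_comp.
Proof. by move=> A B C; exact: op_ext. Qed.
Fact op_comp1l : left_id op_id op_comp.
Proof. by move=> A; exact: op_ext. Qed.
Fact op_comp1r : right_id op_id op_comp.
Proof. by move=> A; exact: op_ext. Qed.
Fact op_compDl : left_distributive op_comp +%R.
Proof. by move=> A B C; exact: op_ext. Qed.
Fact op_compDr : right_distributive op_comp +%R.
Proof. by move=> A B C; apply: op_ext => x; exact: (linearD A). Qed.

(* [pzRingType] rather than [nzRingType]: [X] may be the zero space. *)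
HB.instance Definition _ := GRing.Zmodule_isPzRing.Build bounded_op
  op_compA op_comp1l op_comp1r op_compDl op_compDr.

Lemma op_mulE (A B : bounded_op) x : (A * B) x = A (B x).
Proof. by []. Qed.

Lemma op_oneE x : (1 : bounded_op) x = x.
Proof. by []. Qed.


(* The norm of a normed module over [R[i]] is [R[i]]-valued; its values are
   real, and [Re] brings them back into [R] so that suprema can be taken. *)
Definition real_norm (x : X) : R := complex.Re `|x|.

Definition op_norm (A : bounded_op) : R :=
  sup [set real_norm (A x) | x in [set x | `|x| <= 1]].

Lemma real_normE x : `|x| = (real_norm x)%:C.
Proof. by rewrite /real_norm RRe_real // ger0_real. Qed.

Lemma op_norm_has_sup (A : bounded_op) :
  has_sup [set real_norm (A x) | x in [set x | `|x| <= 1]].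
Proof.
split; first by exists (real_norm (A 0)), 0 => //=; rewrite normr0.
have /linear_boundedP/pinfty_ex_gt0[M M0 AM] :=
  continuous_linear_bounded 0 (@op_continuous A 0).
exists (complex.Re M) => _ [x /= x1 <-].
rewrite -lecR -real_normE RRe_real ?gtr0_real //.
by apply: le_trans (AM x) _; rewrite ler_piMr // ltW.
Qed.

Lemma op_norm_ub (A : bounded_op) x : `|x| <= 1 -> real_norm (A x) <= op_norm A.
Proof.
by move=> x1; apply: ub_le_sup; [case: (op_norm_has_sup A) | exists x].
Qed.

Lemma op_norm_le (A : bounded_op) (M : R) :
  (forall x, `|x| <= 1 -> real_norm (A x) <= M) -> op_norm A <= M.
Proof.
move=> AM; apply: ge_sup; first by case: (op_norm_has_sup A).
by move=> _ [x /= x1 <-]; exact: AM.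
Qed.

Lemma op_norm_ge0 (A : bounded_op) : 0 <= op_norm A.
Proof.
have : real_norm (A 0) <= op_norm A by apply: op_norm_ub; rewrite normr0.
by apply: le_trans; rewrite -lecR -real_normE; exact: normr_ge0.
Qed.

Fact op_norm_triangle (A B : bounded_op) :
  (op_norm (A + B))%:C <= (op_norm A)%:C + (op_norm B)%:C.
Proof.
rewrite -rmorphD lecR; apply: op_norm_le => x x1.
apply: le_trans (lerD (op_norm_ub A x1) (op_norm_ub B x1)).
by rewrite -lecR rmorphD /= -!real_normE ler_normD.
Qed.

Fact op_normZ_le (a : R[i]) (A : bounded_op) :
  (op_norm (a *: A))%:C <= `|a| * (op_norm A)%:C.
Proof.
have aE : `|a| = (complex.Re `|a|)%:C by rewrite RRe_real // ger0_real.
rewrite aE -rmorphM lecR; apply: op_norm_le => x x1.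
rewrite -lecR rmorphM /= -aE -real_normE normrZ ler_wpM2l //.
by rewrite real_normE lecR op_norm_ub.
Qed.

Fact op_normZ (a : R[i]) (A : bounded_op) :
  (op_norm (a *: A))%:C = `|a| * (op_norm A)%:C.
Proof.
apply/eqP; rewrite eq_le op_normZ_le /=.
have [->|a0] := eqVneq a 0; first by rewrite normr0 mul0r lecR op_norm_ge0.
rewrite -ler_pdivlMl ?normr_gt0 // -normfV.
apply: le_trans (op_normZ_le a^-1 (a *: A)).
by rewrite scalerA mulVf // scale1r.
Qed.

Fact op_norm_eq0 (A : bounded_op) : (op_norm A)%:C = 0 -> A = 0.
Proof.
move=> /complexI A0; apply: op_ext => x.
have [->|x0] := eqVneq x 0; first by rewrite linear0.
have : real_norm (A (`|x|^-1 *: x)) <= 0.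
  by rewrite -A0 op_norm_ub // normrZ normfV normr_id mulVf // normr_eq0.
rewrite -lecR -real_normE normr_le0 linearZ scaler_eq0 invr_eq0 normr_eq0.
by rewrite (negbTE x0) => /eqP.
Qed.

HB.instance Definition _ := Lmodule_isNormed.Build R[i] bounded_op
  op_norm_triangle op_normZ op_norm_eq0.

End BoundedOperators.

Section Exponentials.
Variables (R : realType) (X : normedModType R[i]).
Implicit Types (A B : bounded_op X) (tau t : R).

Definition op_exp A : bounded_op X :=
  limn (series (fun k => (k`!%:R : R[i])^-1 *: A ^+ k)).

(* For [t > 0], the index [n] with [n * tau < t <= n.+1 * tau] satisfies
   [n.+1 = ceil (t / tau)]. *)
Definition delayed_exp tau B t : bounded_op X :=
  if t < 0 then 0
  else if t == 0 then 1
  else \sum_(l < `|Num.ceil (t / tau)|%N)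
         ((t - l%:R * tau) ^+ l / l`!%:R)%:C *: B ^+ l.

Lemma delayed_expE tau B t (n : nat) : 0 < tau ->
  n%:R * tau < t <= n.+1%:R * tau ->
  delayed_exp tau B t =
    \sum_(l < n.+1) ((t - l%:R * tau) ^+ l / l`!%:R)%:C *: B ^+ l.
Proof.
move=> tau0 /andP[nt tn].
have t0 : 0 < t by apply: le_lt_trans nt; rewrite mulr_ge0 // ltW.
rewrite /delayed_exp ltNge (ltW t0) /= gt_eqF //.
suff -> : Num.ceil (t / tau) = n.+1 by [].
apply: ceil_def; rewrite ltr_pdivlMr // ler_pdivrMr // tn andbT.
by rewrite -addn1 PoszD addrK.
Qed.

End Exponentials.

Section FundamentalSolution.
Variables (R : realType) (X : normedModType R[i]).
Implicit Types (S : R -> bounded_op X) (t : R) (L : bounded_op X).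

Definition difference_quotient S t : R -> bounded_op X :=
  fun s => ((s - t)^-1)%:C *: (S s - S t).

Definition right_derivative S t L := difference_quotient S t s @[s --> t^'+] --> L.

Definition left_derivative S t L := difference_quotient S t s @[s --> t^'-] --> L.

(* [S] is a function on [-tau, T]; its values elsewhere are irrelevant.
   The equation is two-sided inside ]0, T[ with one exception: [S] jumps from 0
   to 1 at time 0, so the right-hand side jumps at [tau] and only the right
   derivative can satisfy the equation there (as at 0, where the left one does
   not exist). Continuity of [S] on [0, T] is therefore required separately. *)
Record fundamental_solution (tau T : R) (A0 A1 : bounded_op X) S : Prop := {
  fundsol_history : forall t, - tau <= t < 0 -> S t = 0;
  fundsol_init : S 0 = 1;
  fundsol_continuous : {within `[0, T], continuous S};
  fundsol_right : forall t, 0 <= t < T ->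
    right_derivative S t (A0 * S t + A1 * S (t - tau));
  fundsol_left : forall t, 0 < t <= T -> t != tau ->
    left_derivative S t (A0 * S t + A1 * S (t - tau))
}.

End FundamentalSolution.

(* Main.v *)
Require Import Defs.
From HB Require Import structures.
From mathcomp Require Import all_boot all_order all_algebra.
From mathcomp Require Import complex.
From mathcomp Require Import boolp classical_sets functions reals.
From mathcomp Require Import topology normedtype sequences.
From mathcomp Require Import derive exp.

Set Implicit Arguments.
Unset Strict Implicit.
Unset Printing Implicit Defensive.

Import Order.TTheory GRing.Theory Num.Theory.
Import numFieldNormedType.Exports.

Local Open Scope classical_set_scope.
Local Open Scope ring_scope.
Local Open Scope complex_scope.

(* The candidate S(t) = exp(A0 t) exp_tau(A2 t) solves the equation by the
   product rule: on [n tau, (n+1) tau] the delayed exponential is a polynomial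
   with derivative A2 exp_tau(A2 (t - tau)), and exp(A0 t) A2 equals
   A1 exp(A0 (t - tau)) because A0 and A1 commute. Uniqueness is by the method of
   steps: if W, the difference of two solutions, vanishes up to n tau, then on
   the next interval exp(-A0 t) W(t) is continuous with zero right derivative,
   hence constant, hence zero. *)

(** * Submultiplicative norm estimates and limits in the operator algebra *)

Section OperatorNorm.
Variables (R : realType) (X : normedModType R[i]).
Implicit Types (A B L M : bounded_op X) (a : R).

Lemma norm_opE A : `|A| = (op_norm A)%:C.
Proof. by []. Qed.

Lemma norm_op_le A (x : X) : `|A x| <= (op_norm A)%:C * `|x|.
Proof.
have [->|x0] := eqVneq x 0; first by rewrite linear0 !normr0 mulr0.
have nx : 0 < `|x| by rewrite normr_gt0.
rewrite -ler_pdivrMr // mulrC.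
have -> : `|x|^-1 * `|A x| = `|A (`|x|^-1 *: x)|.
  by rewrite linearZ normrZ normfV normr_id.
rewrite real_normE lecR op_norm_ub // normrZ normfV normr_id mulVf //.
by rewrite gt_eqF.
Qed.

Lemma op_norm_leP A a : 0 <= a ->
  (forall x : X, `|A x| <= a%:C * `|x|) -> op_norm A <= a.
Proof.
move=> a0 Aa; apply: op_norm_le => x x1.
rewrite -lecR -real_normE (le_trans (Aa x)) // ler_piMr //.
by rewrite (lecR 0).
Qed.

Lemma op_normD A B : op_norm (A + B) <= op_norm A + op_norm B.
Proof. by rewrite -lecR rmorphD; exact: op_norm_triangle. Qed.

Lemma op_normN A : op_norm (- A) = op_norm A.
Proof. by apply: complexI; rewrite -!norm_opE normrN. Qed.

Lemma op_norm0 : op_norm (0 : bounded_op X) = 0.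
Proof. by apply: complexI; rewrite -!norm_opE normr0. Qed.

Lemma op_norm_distC A B : op_norm (A - B) = op_norm (B - A).
Proof. by rewrite -op_normN opprB. Qed.

Lemma op_norm_eq0P A : op_norm A = 0 -> A = 0.
Proof. by move=> A0; apply: op_norm_eq0; rewrite A0. Qed.

Lemma op_norm_scale a A : op_norm (a%:C *: A) = `|a| * op_norm A.
Proof.
apply: complexI; rewrite -norm_opE normrZ rmorphM /= -norm_opE.
by rewrite normc_def /= expr0n addr0 sqrtr_sqr.
Qed.

Lemma op_normM A B : op_norm (A * B) <= op_norm A * op_norm B.
Proof.
apply: op_norm_leP => [|x]; first by rewrite mulr_ge0 // op_norm_ge0.
rewrite op_mulE rmorphM /= -mulrA (le_trans (norm_op_le A _)) //.
by rewrite ler_wpM2l ?norm_op_le // (lecR 0) op_norm_ge0.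
Qed.

Lemma op_norm1 : op_norm (1 : bounded_op X) <= 1.
Proof. by apply: op_norm_leP => // x; rewrite op_oneE mul1r. Qed.

Lemma op_normX A k : op_norm (A ^+ k) <= op_norm A ^+ k.
Proof.
elim: k => [|k IH]; first by rewrite !expr0 op_norm1.
by rewrite !exprS (le_trans (op_normM _ _)) // ler_wpM2l // op_norm_ge0.
Qed.

Lemma op_norm_sum (I : Type) (r : seq I) (P : pred I) (F : I -> bounded_op X) :
  op_norm (\sum_(i <- r | P i) F i) <= \sum_(i <- r | P i) op_norm (F i).
Proof.
elim/big_ind2 : _ => // [|x1 x2 y1 y2 h1 h2]; first by rewrite op_norm0.
by rewrite (le_trans (op_normD _ _)) // lerD.
Qed.

Lemma op_scaleAl (c : R[i]) A B : (c *: A) * B = c *: (A * B).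
Proof. by apply: op_ext. Qed.

Lemma op_scaleAr (c : R[i]) A B : A * (c *: B) = c *: (A * B).
Proof. by apply: op_ext => x; rewrite op_scaleE !op_mulE op_scaleE linearZ. Qed.

Lemma commr_op_scale (c : R[i]) A B : GRing.comm A B -> GRing.comm A (c *: B).
Proof. by rewrite /GRing.comm => AB; rewrite op_scaleAl op_scaleAr AB. Qed.

(** The norm of [bounded_op X] takes values in [R[i]]. Since a positive element of [R[i]] is real,
    convergence can be moved to the real function [op_norm], where squeezing is available. *)
Lemma cvg_opP (T : Type) (F : set_system T) {FF : Filter F}
    (f : T -> bounded_op X) L :
  f x @[x --> F] --> L <-> op_norm (f x - L) @[x --> F] --> (0 : R).
Proof.
split=> [/cvgrPdist_lt fL|/cvgrPdist_lt fL]; apply/cvgrPdist_lt => e e0.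
  have eC : 0 < e%:C by rewrite (ltcR 0).
  apply: filterS (fL _ eC) => x.
  by rewrite norm_opE ltcR op_norm_distC sub0r normrN ger0_norm // op_norm_ge0.
have eE : e = (complex.Re e)%:C by rewrite RRe_real // gtr0_real.
have e0' : 0 < complex.Re e by rewrite -ltcR -eE.
apply: filterS (fL _ e0') => x.
rewrite eE norm_opE ltcR op_norm_distC sub0r normrN ger0_norm //.
exact: op_norm_ge0.
Qed.

Lemma cvg_op_squeeze (T : Type) (F : set_system T) {FF : Filter F}
    (f : T -> bounded_op X) (g : T -> R) L :
  (\forall x \near F, op_norm (f x - L) <= g x) -> g x @[x --> F] --> (0 : R) ->
  f x @[x --> F] --> L.
Proof.
move=> fg g0; apply/cvg_opP; apply: squeeze_cvgr (cvg_cst (0 : R)) g0.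
by apply: filterS fg => x ->; rewrite op_norm_ge0.
Qed.

(** The error [f g - L M] is split as [(f - L)(g - M) + (f - L) M + L (g - M)]; the norm of each
    summand tends to zero. *)
Lemma cvg_opM (T : Type) (F : set_system T) {FF : Filter F}
    (f g : T -> bounded_op X) L M :
  f x @[x --> F] --> L -> g x @[x --> F] --> M ->
  f x * g x @[x --> F] --> L * M.
Proof.
move=> /cvg_opP fL /cvg_opP gM.
pose h x := op_norm (f x - L) * op_norm (g x - M)
  + (op_norm (f x - L) * op_norm M + op_norm L * op_norm (g x - M)).
apply: (@cvg_op_squeeze _ _ _ _ h).
  apply: nearW => x.
  have -> : f x * g x - L * M = (f x - L) * (g x - M)
      + ((f x - L) * M + L * (g x - M)).
    rewrite addrA -mulrDr subrK mulrBl mulrBr addrA.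
    by rewrite [f x * g x - _ + _]addrNK.
  by do 2?[rewrite (le_trans (op_normD _ _)) // lerD // ?op_normM].
rewrite -[X in _ --> X](_ : 0 * 0 + (0 * op_norm M + op_norm L * 0) = 0).
  apply: cvgD; first exact: cvgM.
  by apply: cvgD; apply: cvgM => //; exact: cvg_cst.
by rewrite !mul0r mulr0 !addr0.
Qed.

Lemma cvg_op_norm (T : Type) (F : set_system T) {FF : Filter F}
    (f : T -> bounded_op X) L :
  f x @[x --> F] --> L -> op_norm (f x) @[x --> F] --> op_norm L.
Proof.
move=> /cvg_opP/cvgrPdist_lt fL; apply/cvgrPdist_lt => e /fL.
apply: filterS => x; rewrite sub0r normrN ger0_norm ?op_norm_ge0 //.
apply: le_lt_trans; rewrite op_norm_distC -lecR.
have := ler_dist_dist L (f x); rewrite !norm_opE -rmorphB /= normc_def /=.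
by rewrite expr0n addr0 sqrtr_sqr.
Qed.

Lemma cvg_op_unique (T : Type) (F : set_system T) {FF : ProperFilter F}
    (f : T -> bounded_op X) L M :
  f x @[x --> F] --> L -> f x @[x --> F] --> M -> L = M.
Proof. by move=> /(cvg_unique (@norm_hausdorff _ _))/[apply]. Qed.

End OperatorNorm.

(** * Weierstrass test for series of operators on a Banach space *)

Section OperatorSeries.
Variables (R : realType) (X : completeNormedModType R[i]).
Variables (u : nat -> bounded_op X) (v : nat -> R).
Hypothesis uv : forall k, op_norm (u k) <= v k.
Hypothesis cv : cvgn (series v).

(** The factor in front of [|x|] is independent of [x]; this uniformity later turns pointwise
    convergence into convergence in norm. *)
Let tail (x : X) n m : (n <= m)%N ->
  `|series u m x - series u n x| <= (series v m - series v n)%:C * `|x|.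
Proof.
move=> nm; have -> : series u m x - series u n x = (series u m - series u n) x.
  by [].
rewrite !sub_series nm (le_trans (norm_op_le _ _)) // ler_wpM2r // lecR.
by rewrite (le_trans (op_norm_sum _ _ _)) // ler_sum.
Qed.

Let v_nondecr : nondecreasing_seq (series v).
Proof.
apply: nondecreasing_series => k _ _.
by rewrite (le_trans (op_norm_ge0 (u k))).
Qed.

Let V := limn (series v).

Let tail_lim (x : X) n m : (n <= m)%N ->
  `|series u m x - series u n x| <= (V - series v n)%:C * `|x|.
Proof.
move=> nm; rewrite (le_trans (tail x nm)) // ler_wpM2r // lecR lerD2r.
exact: nondecreasing_cvgn_le.
Qed.

Let cvg_pointwise (x : X) : cvgn (fun n => series u n x).
Proof.
apply/cauchy_cvgP/cauchy_ballP => e e0.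
have eE : e = (complex.Re e)%:C by rewrite RRe_real // gtr0_real.
have e0' : 0 < complex.Re e by rewrite -ltcR -eE.
set r := real_norm x.
have r0 : 0 <= r by rewrite -lecR -real_normE; exact: normr_ge0.
(* Two tails measured from the same index [N] share [e], hence the half. Dividing by [r + 1] instead
   of [r] also covers [x = 0]. *)
have c0 : 0 < complex.Re e / 2 / (r + 1).
  by rewrite !divr_gt0 // ltr_wpDl.
have /cvgrPdist_lt/(_ _ c0)[N _ HN] := cv.
have key n : (N <= n)%N ->
    `|series u n x - series u N x| < (complex.Re e / 2)%:C.
  move=> Nn; apply: le_lt_trans (tail_lim x Nn) _.
  rewrite real_normE -rmorphM /= ltcR -/r.
  have := HN N (leqnn N); rewrite /= ltr_norml => /andP[_ lt1].
  have : (V - series v N) * (r + 1) < complex.Re e / 2.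
    by rewrite -ltr_pdivlMr // ltr_wpDl.
  apply: le_lt_trans; rewrite ler_wpM2l // ?lerDl // subr_ge0.
  exact: nondecreasing_cvgn_le.
near_simpl; exists ([set n | (N <= n)%N], [set n | (N <= n)%N]) => /=.
  by split; exists N.
move=> [n m] /= [Nn Nm]; rewrite -ball_normE /=.
rewrite -(subrKA (series u N x)) (le_lt_trans (ler_normD _ _)) //.
rewrite eE (splitr (complex.Re e)) rmorphD /= ltrD ?key //.
by rewrite distrC key.
Qed.

Let f (x : X) : X := limn (fun n => series u n x).

Let f_bound (x : X) n : `|f x - series u n x| <= (V - series v n)%:C * `|x|.
Proof.
apply/ler_addgt0Pr => e e0.
have /cvgrPdist_lt/(_ _ e0)[N _ HN] := @cvg_pointwise x.
(* Beyond [n] the tail bound applies, and beyond [N] the partial sum is within [e] of the limit. *)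
pose m := maxn n N.
have := HN m (leq_maxr _ _); rewrite /= -/(f x) => /ltW fm.
rewrite -(subrKA (series u m x)) addrC (le_trans (ler_normD _ _)) //.
by rewrite lerD // tail_lim // leq_maxl.
Qed.

Let f_linear : linear f.
Proof.
move=> c x y; apply: cvg_lim; first exact: norm_hausdorff.
have -> : (fun n => series u n (c *: x + y)) =
    (fun n => c *: series u n x + series u n y).
  by apply/funext => n; rewrite linearP.
by apply: cvgD; [apply: cvgZl_tmp|]; exact: cvg_pointwise.
Qed.

HB.instance Definition _ := GRing.isLinear.Build R[i] X X *:%R f f_linear.

Let f_bounded : f \in @bounded_linear R X.
Proof.
apply/asboolP; split; first exact: f_linear.
apply: bounded_linear_continuous; apply/linear_boundedP.
near=> r; move=> x.
(* At index 0 both partial sums are empty, so the tail bound reads [|f x| <= V |x|]. *)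
have := f_bound x 0; rewrite /series /= !big_geq // op_zeroE !subr0.
move/le_trans; apply; rewrite ler_wpM2r //.
by near: r; apply: nbhs_pinfty_ge; apply/complex_realP; exists V.
Unshelve. all: by end_near.
Qed.

(** Completeness of [X] gives the pointwise limit [f], which is linear and bounded; the uniform tail
    bound [V - series v n] then tends to zero and gives convergence in operator norm. *)
Lemma op_series_cvg : cvgn (series u).
Proof.
apply/cvg_ex; exists (BoundedOp f_bounded).
apply: (@cvg_op_squeeze _ _ _ _ _ _ (fun n => V - series v n)).
  apply: nearW => n; rewrite op_norm_distC.
  apply: op_norm_leP => [|x]; last exact: f_bound.
  by rewrite subr_ge0 nondecreasing_cvgn_le.
rewrite -[X in _ --> X](subrr V).
by apply: cvgB; [exact: cvg_cst|exact: cv].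
Qed.

End OperatorSeries.

(** * Finite Cauchy products and their remainder *)

Section CauchyProduct.

(** Summing a triangle of indices along antidiagonals agrees with summing it by rows, after
    exchanging the two sums and shifting the inner index by [i]. *)
Lemma sum_triangle (V : zmodType) (F : nat -> nat -> V) n :
  \sum_(k < n) \sum_(i < k.+1) F (k - i)%N i =
  \sum_(i < n) \sum_(j < n | (i + j < n)%N) F i j.
Proof.
transitivity (\sum_(i < n) \sum_(k < n | (i <= k)%N) F (k - i)%N i).
  rewrite (exchange_big_dep predT) //=; apply: eq_bigr => k _.
  by rewrite (big_ord_widen n (fun i => F (k - i)%N i)).
rewrite [RHS](exchange_big_dep predT) //=; apply: eq_bigr => i _.
rewrite -(big_mkord (fun k => (i <= k)%N) (fun k => F (k - i)%N i)).
rewrite -(big_mkord (fun k => (k + i < n)%N) (fun k => F k i)).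
rewrite -(big_nat_widenl i 0 n predT (fun k => F (k - i)%N i)) //.
rewrite -{1}[i : nat]add0n big_addn.
rewrite (big_nat_widen 0 (n - i) n) ?leq_subr //.
apply: eq_big => [k|k _]; last by rewrite addnK.
by rewrite ltn_subRL addnC.
Qed.

(** The square of index pairs loses its lower triangle. Stated for any ring so that the operator
    remainder and the scalar one have the same shape and can be compared term by term. *)
Lemma cauchy_product (A : pzRingType) (a b : nat -> A) n :
  (\sum_(i < n) a i) * (\sum_(i < n) b i) -
    \sum_(k < n) \sum_(i < k.+1) a (k - i)%N * b i =
  \sum_(i < n) \sum_(j < n | (n <= i + j)%N) a i * b j.
Proof.
rewrite (sum_triangle (fun i j => a i * b j)) mulr_suml -sumrB.
apply: eq_bigr => i _; rewrite mulr_sumr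
  (bigID (fun j : 'I_n => (i + j < n)%N)).
by rewrite /= addrAC subrr add0r; apply: eq_bigl => j; rewrite -leqNgt.
Qed.

Lemma bin_fact_field (F : numFieldType) (k i : nat) : (i <= k)%N ->
  (k`!%:R)^-1 * 'C(k, i)%:R = ((k - i)`!%:R)^-1 * (i`!%:R)^-1 :> F.
Proof.
move=> ik; have nz j : (j`!%:R : F) != 0 by rewrite pnatr_eq0 -lt0n fact_gt0.
apply: (mulfI (nz k)); rewrite mulVKf // -(bin_fact ik) !natrM.
by rewrite [X in _ = _ * X]mulrC -invfM mulfK // mulf_neq0.
Qed.

End CauchyProduct.

(** * The operator exponential and its functional equation *)

Section OperatorExponential.
Variables (R : realType) (X : completeNormedModType R[i]).
Implicit Types (A B L : bounded_op X) (t : R).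

Definition exp_term A k : bounded_op X := (k`!%:R : R[i])^-1 *: A ^+ k.

Lemma exp_term_norm A k : op_norm (exp_term A k) <= exp_coeff (op_norm A) k.
Proof.
rewrite /exp_term -(rmorph_nat (real_complex R)) -fmorphV op_norm_scale.
rewrite ger0_norm ?invr_ge0 // /exp_coeff /= mulrC ler_wpM2r ?invr_ge0 //.
exact: op_normX.
Qed.

Lemma cvg_op_exp A : series (exp_term A) n @[n --> \oo] --> op_exp A.
Proof.
exact: (op_series_cvg (exp_term_norm A) (is_cvg_series_exp_coeff (op_norm A))).
Qed.

Lemma op_exp0 : op_exp (0 : bounded_op X) = 1.
Proof.
apply: (cvg_op_unique (@cvg_op_exp 0)).
(* The partial sum of index 0 is empty; after a shift by one, all partial sums equal 1. *)
rewrite -(cvg_shiftn 1 (series (exp_term 0))).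
under eq_cvg.
  move=> n; rewrite seriesEord /= addn1 big_ord_recl big1 => [|i _]; last first.
    by rewrite /exp_term expr0n scaler0.
  rewrite addr0 /exp_term expr0 invr1 scale1r; over.
exact: cvg_cst.
Qed.

(** [B] commutes with every partial sum, and both products pass to the limit. *)
Lemma comm_op_exp A B : GRing.comm B A -> GRing.comm B (op_exp A).
Proof.
move=> BA; have c n : GRing.comm B (series (exp_term A) n).
  rewrite /series /=; apply: commr_sum => k _.
  by apply: commr_op_scale; exact: commrX.
apply: (cvg_op_unique (cvg_opM (cvg_cst B) (@cvg_op_exp A))).
under eq_cvg do rewrite c.
exact: (cvg_opM (@cvg_op_exp A) (cvg_cst B)).
Qed.

Lemma exp_termD A B k : GRing.comm A B ->
  exp_term (A + B) k = \sum_(i < k.+1) exp_term A (k - i)%N * exp_term B i.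
Proof.
move=> AB; rewrite /exp_term exprDn_comm // scaler_sumr; apply: eq_bigr => i _.
rewrite op_scaleAl op_scaleAr scalerA -(bin_fact_field _ (leq_ord i)).
by rewrite -scalerA scaler_nat.
Qed.

Lemma exp_coeffD (a b : R) k :
  exp_coeff (a + b) k = \sum_(i < k.+1) exp_coeff a (k - i)%N * exp_coeff b i.
Proof.
rewrite /exp_coeff /= exprDn mulr_suml; apply: eq_bigr => i _.
rewrite mulrACA -(bin_fact_field _ (leq_ord i)).
by rewrite -mulr_natr -!mulrA; congr (_ * (_ * _)); rewrite mulrC.
Qed.

(* The Cauchy product error is dominated by that of the real exponential. *)
Lemma op_expD A B : GRing.comm A B -> op_exp (A + B) = op_exp A * op_exp B.
Proof.
move=> AB; set a := op_norm A; set b := op_norm B.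
apply/esym/(cvg_op_unique (cvg_opM (@cvg_op_exp A) (@cvg_op_exp B))).
pose g n := series (exp_coeff a) n * series (exp_coeff b) n
  - series (exp_coeff (a + b)) n.
pose P C n := series (exp_term C) n.
have Pg n : op_norm (P A n * P B n - P (A + B) n) <= g n.
  rewrite /P /g !seriesEord /=.
  under [X in _ - X]eq_bigr do rewrite exp_termD //.
  under [X in _ <= _ - X]eq_bigr do rewrite exp_coeffD //.
  rewrite !cauchy_product (le_trans (op_norm_sum _ _ _)) // ler_sum // => i _.
  rewrite (le_trans (op_norm_sum _ _ _)) // ler_sum // => j _.
  by rewrite (le_trans (op_normM _ _)) // ler_pM ?op_norm_ge0 ?exp_term_norm.
have g0 : g n @[n --> \oo] --> (0 : R).
  rewrite -[X in _ --> X](subrr (expR (a + b))) {1}expRD.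
  by apply: cvgB; [apply: cvgM|]; exact: is_cvg_series_exp_coeff.
have err0 : P A n * P B n - P (A + B) n @[n --> \oo] --> (0 : bounded_op X).
  apply: (@cvg_op_squeeze _ _ _ _ _ _ g) => //.
  by apply: nearW => n; rewrite subr0.
rewrite -[op_exp _]addr0.
have -> : (fun n => series (exp_term A) n * series (exp_term B) n) =
    (fun n => P (A + B) n + (P A n * P B n - P (A + B) n)).
  by apply/funext => n; rewrite addrC subrK.
exact: (cvgD (@cvg_op_exp (A + B)) err0).
Qed.

End OperatorExponential.

Arguments cvg_op_exp {R X} A.

(** * Calculus of derivatives along a filter *)

Section DerivativeAlong.
Variables (R : realType) (X : normedModType R[i]).
Implicit Types (S : R -> bounded_op X) (t : R) (A B L M : bounded_op X).

(* [F] will be one of [t^'], [t^'+], [t^'-]. *)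
Definition derivative_along (F : set_system R) S t L :=
  difference_quotient S t s @[s --> F] --> L.

Variables (t : R) (F : set_system R).
Context {FF : Filter F}.
Hypothesis Ft : F `=>` t^'.

Let near_ne : \forall s \near F, s != t.
Proof. by have := nbhs_dnbhs_neq t; apply: Ft. Qed.

Lemma cvg_along_id : s @[s --> F] --> t.
Proof. by move=> P /nbhs_dnbhs; exact: Ft. Qed.

(** Away from [t], the norm of [S s - S t] is [|s - t|] times that of the difference quotient, and
    the latter is controlled by its limit [L]. *)
Lemma derivative_along_cvg S L :
  derivative_along F S t L -> S s @[s --> F] --> S t.
Proof.
move=> SL; apply/cvg_opP.
have key : `|s - t| * op_norm (difference_quotient S t s) @[s --> F] -->
    (0 : R).
  have /cvg_opP SL' := SL.
  apply: (@squeeze_cvgr _ _ _ _ (fun=> 0) (fun s => `|s - t| *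
      (op_norm (difference_quotient S t s - L) + op_norm L))).
  - apply: nearW => s; rewrite mulr_ge0 ?op_norm_ge0 // ler_wpM2l //.
    by rewrite -{1}(subrK L (difference_quotient S t s)) op_normD.
  - exact: cvg_cst.
  rewrite -[X in _ --> X](_ : `|t - t| * (0 + op_norm L) = 0); last first.
    by rewrite subrr normr0 mul0r.
  apply: cvgM; last by apply: cvgD => //; exact: cvg_cst.
  by apply: cvg_norm; apply: cvgB; [exact: cvg_along_id|exact: cvg_cst].
apply: cvg_trans key; apply: near_eq_cvg.
apply: filterS near_ne => s st; rewrite /difference_quotient op_norm_scale.
by rewrite mulrA -normrM divff ?subr_eq0 // normr1 mul1r.
Qed.

Lemma derivative_along_eq S S' L : S t = S' t ->
  (\forall s \near F, S s = S' s) ->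
  derivative_along F S t L -> derivative_along F S' t L.
Proof.
move=> St Ss; apply: cvg_trans; apply: near_eq_cvg.
by apply: filterS Ss => s ss; rewrite /difference_quotient St ss.
Qed.

Lemma derivative_alongB S S' L M :
  derivative_along F S t L -> derivative_along F S' t M ->
  derivative_along F (fun s => S s - S' s) t (L - M).
Proof.
move=> SL SM; apply: cvg_trans (cvgB SL SM); apply: near_eq_cvg.
apply: nearW => s; rewrite fctE /difference_quotient -scalerBr.
by rewrite !opprD addrACA.
Qed.

Lemma derivative_along_sum (I : Type) (r : seq I) (S : I -> R -> bounded_op X)
    (L : I -> bounded_op X) :
  (forall i, derivative_along F (S i) t (L i)) ->
  derivative_along F (fun s => \sum_(i <- r) S i s) t (\sum_(i <- r) L i).
Proof.
move=> SL; rewrite /derivative_along.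
have -> : difference_quotient (fun s => \sum_(i <- r) S i s) t =
    (fun s => \sum_(i <- r) difference_quotient (S i) t s).
  by apply/funext => s; rewrite /difference_quotient -sumrB scaler_sumr.
by apply: cvg_big => [|i _]; [exact: add_continuous|exact: SL].
Qed.

(** The quotient of the product splits with the second factor frozen at [t] and the first one
    moving, so continuity of [S] along [F] enters. The order of the factors is kept, as operators
    need not commute. *)
Lemma derivative_alongM S S' L M :
  derivative_along F S t L -> derivative_along F S' t M ->
  derivative_along F (fun s => S s * S' s) t (L * S' t + S t * M).
Proof.
move=> SL SM; have cS := derivative_along_cvg SL.
have key : difference_quotient S t s * S' t + S s * difference_quotient S' t s
    @[s --> F] --> L * S' t + S t * M.
  by apply: cvgD; [exact: (cvg_opM SL (cvg_cst (S' t)))|exact: (cvg_opM cS SM)].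
apply: cvg_trans key; apply: near_eq_cvg; apply: nearW => s /=.
rewrite /difference_quotient op_scaleAl op_scaleAr -scalerDr; congr (_ *: _).
by rewrite mulrBl mulrBr addrC addrA subrK.
Qed.

Lemma cvg_along_sub : s - t @[s --> F] --> 0^'.
Proof.
move=> P [e /= e0 eP]; apply: Ft; exists e => //= s st s_ne.
apply: eP; last by rewrite subr_eq0.
by rewrite /= sub0r normrN distrC.
Qed.

Lemma derivative_along_scalar (f : R -> R) (df : R) B : is_derive t 1 f df ->
  derivative_along F (fun s => (f s)%:C *: B) t (df%:C *: B).
Proof.
move=> [fl dfE]; have {fl} := fl : _ --> 'D_1 f t; rewrite dfE => fl.
(* The derivative ['D_1 f t] is a limit in the increment; substituting [s - t] for it gives a limit
   along [F]. *)
have {}fl := @cvg_comp _ _ _ (fun s => s - t) _ F _ _ (@cvg_along_sub) fl.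
apply: (@cvg_op_squeeze _ _ _ _ _ _
  (fun s => `|(s - t)^-1 * (f s - f t) - df| * op_norm B)).
  apply: nearW => s; rewrite /difference_quotient -scalerBl scalerA -scalerBl.
  by rewrite -rmorphB -rmorphM -rmorphB op_norm_scale.
rewrite -[X in _ --> X](_ : `|df - df| * op_norm B = 0); last first.
  by rewrite subrr normr0 mul0r.
apply: cvgM; last exact: cvg_cst.
apply: cvg_norm; apply: cvgB; last exact: cvg_cst.
apply: cvg_trans fl; apply: near_eq_cvg; apply: nearW => s /=.
by rewrite [_ *: 1]mulr1 subrK.
Qed.

End DerivativeAlong.

(** * Derivative of the operator exponential *)

Section ExponentialDerivative.
Variables (R : realType) (X : completeNormedModType R[i]).
Implicit Types (A B : bounded_op X) (s t : R).

(** The terms of degree 0 and 1 cancel, and [1/(k+2)! <= 1/k!] bounds the remaining ones by [a ^+ 2]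
    times the exponential series of [a]. *)
Lemma op_exp_sub1_norm A :
  op_norm (op_exp A - 1 - A) <= op_norm A ^+ 2 * expR (op_norm A).
Proof.
set a := op_norm A; have a0 : 0 <= a by exact: op_norm_ge0.
have bound n : op_norm (series (exp_term A) n.+2 - 1 - A) <= a ^+ 2 * expR a.
  rewrite seriesEord /= big_ord_recl big_ord_recl /=.
  rewrite {1 2}/exp_term /bump /= invr1 !scale1r expr0 expr1.
  rewrite [X in X - 1]addrC addrK [X in op_norm X]addrC addKr.
  rewrite (le_trans (op_norm_sum _ _ _)) //.
  apply: (@le_trans _ _ (a ^+ 2 * series (exp_coeff a) n)); last first.
    rewrite ler_wpM2l ?exprn_ge0 //.
    apply: nondecreasing_cvgn_le; last exact: is_cvg_series_exp_coeff.
    by apply: nondecreasing_series => k _ _; exact: exp_coeff_ge0.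
  rewrite seriesEord /= mulr_sumr ler_sum // => k _.
  rewrite (le_trans (exp_term_norm _ _)) // -/a /exp_coeff /= mulrA -exprD.
  rewrite ler_wpM2l ?exprn_ge0 // lef_pV2 ?posrE ?ltr0n ?fact_gt0 //.
  by rewrite ler_nat; apply: leq_fact; rewrite (leq_trans (leqnSn k)).
have c : op_norm (series (exp_term A) (n + 2) - 1 - A) @[n --> \oo] -->
    op_norm (op_exp A - 1 - A).
  apply: cvg_op_norm; apply: cvgB; last exact: cvg_cst.
  apply: cvgB; last exact: cvg_cst.
  by rewrite (cvg_shiftn 2 (series (exp_term A))); exact: cvg_op_exp.
rewrite -(cvg_lim _ c) //; apply: limr_le; first exact: cvgP c.
by apply: nearW => n; move: (bound n); rewrite -addn2.
Qed.

Lemma comm_exp_scale A (c d : R[i]) : GRing.comm (c *: A) (d *: A).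
Proof. by do 2?[apply: commr_op_scale; apply: commr_sym]. Qed.

Lemma op_exp_add A s t :
  op_exp ((s + t)%:C *: A) = op_exp (s%:C *: A) * op_exp (t%:C *: A).
Proof. by rewrite rmorphD /= scalerDl op_expD //; exact: comm_exp_scale. Qed.

Lemma op_exp_derivative A t :
  derivative_along t^' (fun s => op_exp (s%:C *: A)) t (A * op_exp (t%:C *: A)).
Proof.
rewrite /derivative_along; pose E s := op_exp (s%:C *: A).
(* By the functional equation [E s - E t = (E (s - t) - 1) * E t], which leaves the derivative at
   zero. *)
suff EA : (s - t)^-1%:C *: (E (s - t) - 1) @[s --> t^'] --> A.
  have key : (s - t)^-1%:C *: (E (s - t) - 1) * E t @[s --> t^'] --> A * E t.
    exact: (cvg_opM EA (cvg_cst (E t))).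
  apply: cvg_trans key; apply: near_eq_cvg.
  apply: nearW => s; rewrite /difference_quotient op_scaleAl mulrBl mul1r.
  by rewrite /E -op_exp_add subrK.
set a := op_norm A; have a0 : 0 <= a by exact: op_norm_ge0.
apply: (@cvg_op_squeeze _ _ _ _ _ _ (fun s => `|s - t| * (a ^+ 2 * expR a))).
  (* The bound [|s - t| < 1] replaces the factor [expR (|s - t| * a)] of the quadratic remainder by
     the constant [expR a]. *)
  have : \forall s \near t^', `|s - t| < 1 /\ s != t.
    near=> s; split; near: s; last exact: nbhs_dnbhs_neq.
    by apply: nbhs_dnbhs; exists 1 => //= s; rewrite distrC.
  apply: filterS => s [st1 st]; have st0 : s - t != 0 by rewrite subr_eq0.
  have -> : (s - t)^-1%:C *: (E (s - t) - 1) - A =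
      (s - t)^-1%:C *: (E (s - t) - 1 - (s - t)%:C *: A).
    by rewrite [RHS]scalerBr scalerA -rmorphM /= mulVf // scale1r.
  rewrite op_norm_scale normfV ler_pdivrMl ?normr_gt0 //.
  rewrite (le_trans (op_exp_sub1_norm _)) // op_norm_scale -/a.
  rewrite exprMn [leRHS]mulrA -expr2 -mulrA.
  rewrite ler_wpM2l ?exprn_ge0 // ler_wpM2l ?exprn_ge0 //.
  by rewrite ler_expR ler_piMl // ltW.
rewrite -[X in _ --> X](_ : `|t - t| * (a ^+ 2 * expR a) = 0); last first.
  by rewrite subrr normr0 mul0r.
apply: cvgM; last exact: cvg_cst.
apply: cvg_norm; apply: cvgB; last exact: cvg_cst.
exact: (@cvg_along_id _ t t^').
Unshelve. all: by end_near. Qed.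

End ExponentialDerivative.

Lemma is_derive_taylor_monomial (R : realType) (c t : R) l :
  is_derive t 1 (fun s => (s - c) ^+ l / l`!%:R)
    (l%:R * (t - c) ^+ l.-1 / l`!%:R).
Proof.
(* For [l = 0] the predecessor [l.-1] defaults to 0, but the factor [l%:R] vanishes. *)
case: l => [|l].
  rewrite !mul0r (_ : (fun s => _) = cst 1); first exact: is_derive_cst.
  by apply/funext => s; rewrite expr0 divr1.
rewrite (_ : (fun s => _) = (l.+1`!%:R^-1 : R) *: (id - cst c) ^+ l.+1).
  by apply: is_derive_eq; rewrite subr0 /= [_ *: 1]mulr1 [RHS]mulrC !fctE.
by apply/funext => s; rewrite !fctE mulrC.
Qed.

Lemma at_right_dnbhs (R : realType) (t : R) : t^'+ `=>` t^'.
Proof.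
move=> P [e /= e0 eP]; exists e => //= s st ts.
by apply: eP => //; rewrite gt_eqF.
Qed.

Lemma at_left_dnbhs (R : realType) (t : R) : t^'- `=>` t^'.
Proof.
move=> P [e /= e0 eP]; exists e => //= s st ts.
by apply: eP => //; rewrite lt_eqF.
Qed.

(** * The delayed exponential as a piecewise polynomial *)

Section DelayedExponential.
Variables (R : realType) (X : normedModType R[i]).
Variables (tau : R) (B : bounded_op X).
Hypothesis tau0 : 0 < tau.
Implicit Types (s t : R).

(** The polynomial piece valid up to [n * tau], extended to all [t]. For [n = 0] it is the zero
    history, so consecutive pieces are linked by one derivative rule from the first interval on. *)
Definition delayed_poly n t : bounded_op X :=
  \sum_(l < n) ((t - l%:R * tau) ^+ l / l`!%:R)%:C *: B ^+ l.

(* At [t = n * tau] the formulas of the two adjacent intervals agree, since the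
   extra top term vanishes there. *)
Lemma delayed_exp_poly n t : n%:R * tau <= t <= n.+1%:R * tau ->
  delayed_exp tau B t = delayed_poly n.+1 t.
Proof.
rewrite le_eqVlt => /andP[/orP[/eqP <- _|nt tn]]; last first.
  by apply: delayed_expE => //; rewrite nt.
case: n => [|n].
  rewrite mul0r /delayed_exp ltxx eqxx /delayed_poly big_ord1.
  by rewrite !expr0 divr1 scale1r.
rewrite (@delayed_expE _ _ _ _ _ n) //; last first.
  by rewrite lexx andbT ltr_pM2r // ltr_nat.
by rewrite /delayed_poly [RHS]big_ord_recr /= subrr expr0n mul0r scale0r addr0.
Qed.

(* [t = tau] is excluded for [n = 0] since [delayed_exp] jumps from 0 to 1 at 0. *)
Lemma delayed_exp_poly_shift n t : n%:R * tau <= t <= n.+1%:R * tau ->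
  (n == 0)%N ==> (t != tau) ->
  delayed_exp tau B (t - tau) = delayed_poly n (t - tau).
Proof.
case: n => [|n] /andP[nt tn] /= ttau.
  rewrite /delayed_poly big_ord0 /delayed_exp ifT //.
  by rewrite subr_lt0 lt_neqAle ttau; rewrite mul1r in tn.
apply: delayed_exp_poly; rewrite lerBrDr lerBlDr.
by rewrite -{2 4}[tau]mul1r -!mulrDl !natr1 nt.
Qed.

(** The centres [l * tau] are equally spaced: differentiating the term of index [l + 1] gives [B]
    times the term of index [l] at the argument [t - tau]. The constant term drops out. *)
Lemma delayed_poly_derivative (t : R) (F : set_system R) {FF : Filter F} n :
  F `=>` t^' ->
  derivative_along F (delayed_poly n.+1) t (B * delayed_poly n (t - tau)).
Proof.
move=> Ft; have -> : B * delayed_poly n (t - tau) = \sum_(l < n.+1)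
    (l%:R * (t - l%:R * tau) ^+ l.-1 / l`!%:R)%:C *: B ^+ l.
  rewrite big_ord_recl /= !mul0r scale0r add0r /delayed_poly mulr_sumr.
  apply: eq_bigr => l _; rewrite op_scaleAr -exprS /bump /= add1n.
  have -> : t - l.+1%:R * tau = t - tau - l%:R * tau.
    by rewrite -natr1 mulrDl mul1r opprD addrA addrAC.
  congr (_%:C *: _); rewrite factS natrM invfM [RHS]mulrAC.
  by rewrite mulVKf ?pnatr_eq0 // mulrC.
apply: derivative_along_sum => l; apply: derivative_along_scalar => //.
exact: is_derive_taylor_monomial.
Qed.

Lemma delayed_exp_right_derivative n t : n%:R * tau <= t < n.+1%:R * tau ->
  derivative_along t^'+ (delayed_exp tau B) t (B * delayed_poly n (t - tau)).
Proof.
move=> /andP[nt tn].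
have FF : Filter t^'+ by exact: at_right_proper_filter.
have Ft := @at_right_dnbhs _ t.
apply: (derivative_along_eq _ _ (@delayed_poly_derivative t _ _ n Ft)).
  by rewrite (@delayed_exp_poly n) // nt ltW.
near=> s; rewrite (@delayed_exp_poly n) //; apply/andP; split.
  by rewrite (le_trans nt).
by rewrite ltW.
Unshelve. all: by end_near. Qed.

Lemma delayed_exp_left_derivative n t : n%:R * tau < t <= n.+1%:R * tau ->
  derivative_along t^'- (delayed_exp tau B) t (B * delayed_poly n (t - tau)).
Proof.
move=> /andP[nt tn].
have FF : Filter t^'- by exact: at_left_proper_filter.
have Ft := @at_left_dnbhs _ t.
apply: (derivative_along_eq _ _ (@delayed_poly_derivative t _ _ n Ft)).
  by rewrite (@delayed_exp_poly n) // tn ltW.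
near=> s; rewrite (@delayed_exp_poly n) //; apply/andP; split.
  by rewrite ltW.
by rewrite (le_trans _ tn).
Unshelve. all: by end_near. Qed.

End DelayedExponential.

Lemma within_itv_cvg_at_left (R : realType) (K : numDomainType)
    (U : pseudoMetricNormedZmodType K) (a b c : R) (f : R -> U) :
  a < c <= b -> {within `[a, b], continuous f} -> f x @[x --> c^'-] --> f c.
Proof.
move=> /andP[ac cb]; have ab := lt_le_trans ac cb.
move=> /(continuous_within_itvP _ ab)[fab _ fb].
have [->//|c_ne_b] := eqVneq c b; apply: cvg_at_left_filter; apply: fab.
by rewrite in_itv /= ac lt_neqAle c_ne_b.
Qed.

(** * Continuous functions with zero right derivative are constant *)

Section ConstantFunction.
Variables (R : realType) (X : normedModType R[i]).
Variables (a b : R) (V : R -> bounded_op X).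
Hypothesis ab : a < b.
Hypothesis cV : {within `[a, b], continuous V}.
Hypothesis dV : forall t, a <= t < b -> derivative_along t^'+ V t 0.

(** Continuous induction: [c] is the supremum of the times up to which the bound holds. Continuity
    carries the bound to [c], and the zero right derivative carries it past [c] unless [c = b]. *)
Let slope_bound (e : R) : 0 < e ->
  forall t, a <= t <= b -> op_norm (V t - V a) <= e * (t - a).
Proof.
move=> e0; pose P s := op_norm (V s - V a) <= e * (s - a).
pose A := [set t | a <= t <= b /\ forall s, a <= s <= t -> P s].
have Pa : P a by rewrite /P !subrr op_norm0 mulr0.
have Aa : A a.
  split; first by rewrite lexx ltW.
  by move=> s sa; rewrite -(@le_anti _ _ a s) // andbC.
have Aub : ubound A b by move=> t [/andP[]].
have supA : has_sup A by split; [exists a|exists b].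
pose c := sup A.
have ac : a <= c by apply: ub_le_sup => //; exists b.
have cb : c <= b by apply: ge_sup => //; exists a.
have Plt s : a <= s -> s < c -> P s.
  move=> as_ sc; have sc0 : 0 < c - s by rewrite subr_gt0.
  have [t [_ At]] := sup_adherent sc0 supA; rewrite -/c subKr => /ltW st.
  by apply: At; rewrite as_.
have Pc : P c.
  have [<-//|a_ne_c] := eqVneq a c.
  have {}ac : a < c by rewrite lt_neqAle a_ne_c.
  have FF : ProperFilter c^'- by exact: at_left_proper_filter.
  have Vc : op_norm (V s - V a) @[s --> c^'-] --> op_norm (V c - V a).
    apply: cvg_op_norm; apply: cvgB; last exact: cvg_cst.
    by apply: (within_itv_cvg_at_left _ cV); rewrite ac.
  rewrite /P -(cvg_lim _ Vc) //; apply: limr_le; first exact: cvgP Vc.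
  near=> s; have sc : s < c by near: s; exact: nbhs_left_lt.
  apply: (@le_trans _ _ (e * (s - a))); last by rewrite ler_pM2l // lerD2r ltW.
  by apply: Plt => //; apply: ltW; near: s; exact: nbhs_left_gt.
suff -> : b = c.
  move=> t /andP[at_]; rewrite le_eqVlt => /orP[/eqP->//|]; exact: Plt.
apply/eqP; rewrite eq_le cb andbT leNgt; apply/negP => c_lt_b.
have /dV /cvg_opP/cvgrPdist_lt/(_ _ e0)[d /= d0 dP] : a <= c < b by rewrite ac.
(* Halving [d] keeps all of []c, u]] strictly inside the neighbourhood where the quotient has norm
   below [e]. *)
pose u := Num.min b (c + d / 2).
have cu : c < u by rewrite lt_min c_lt_b ltrDl divr_gt0.
have : u <= c.
  apply: ub_le_sup; first by exists b.
  split; first by rewrite (le_trans ac (ltW cu)) ge_min lexx.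
  move=> s /andP[as_ su]; have [sc|cs] := ltP s c; first exact: Plt.
  move: cs; rewrite le_eqVlt => /orP[/eqP<-//|cs].
  have /dP /(_ cs) : `|c - s| < d.
    rewrite distrC ger0_norm ?subr_ge0 1?ltW // ltrBlDl.
    apply: le_lt_trans su _; rewrite /u gt_min ltrD2l.
    by rewrite ltr_pdivrMr // ltr_pMr // ltr1n orbT.
  rewrite sub0r normrN subr0 ger0_norm ?op_norm_ge0 //.
  rewrite /difference_quotient op_norm_scale ger0_norm; last first.
    by rewrite invr_ge0 subr_ge0 ltW.
  rewrite mulrC ltr_pdivrMr ?subr_gt0 // => /ltW sc.
  rewrite /P -(subrKA (V c)) (le_trans (op_normD _ _)) //.
  by rewrite -(subrKA c s) mulrDr lerD.
by rewrite leNgt cu.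
Unshelve. all: by end_near. Qed.

Lemma zero_right_derivative_constant t : a <= t <= b -> V t = V a.
Proof.
move=> tab; apply/eqP; rewrite -subr_eq0; apply/eqP/op_norm_eq0P/eqP.
rewrite eq_le op_norm_ge0 andbT; apply/ler_addgt0Pr => e e0; rewrite add0r.
have ba0 : 0 < b - a by rewrite subr_gt0.
apply: le_trans (slope_bound (divr_gt0 e0 ba0) tab) _.
rewrite -mulrA ler_piMr ?(ltW e0) // ler_pdivrMl // mulr1 lerD2r.
by case/andP: tab.
Qed.

End ConstantFunction.

Section Solution.
Variables (R : realType) (X : completeNormedModType R[i]).
Implicit Types (A : bounded_op X) (s t : R).

Lemma op_exp_one_sided_derivative A t (F : set_system R) : F `=>` t^' ->
  derivative_along F (fun s => op_exp (s%:C *: A)) t (A * op_exp (t%:C *: A)).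
Proof.
move=> Ft; apply: cvg_trans (@op_exp_derivative _ _ A t).
exact: cvg_app.
Qed.

Lemma op_exp_continuous A : continuous (fun s => op_exp (s%:C *: A)).
Proof.
move=> t; apply/left_right_continuousP; split.
  have FF : Filter t^'- by exact: at_left_proper_filter.
  have Ft := @at_left_dnbhs _ t.
  exact: (derivative_along_cvg Ft (@op_exp_one_sided_derivative A _ _ Ft)).
have FF : Filter t^'+ by exact: at_right_proper_filter.
have Ft := @at_right_dnbhs _ t.
exact: (derivative_along_cvg Ft (@op_exp_one_sided_derivative A _ _ Ft)).
Qed.

Lemma op_exp_mulN A t : op_exp (t%:C *: A) * op_exp (t%:C *: - A) = 1.
Proof.
rewrite -op_expD; first by rewrite scalerN subrr op_exp0.
apply: commr_sym; rewrite scalerN.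
by apply: commr_sym; apply: commrN.
Qed.

Variables (tau : R) (A0 A1 : bounded_op X).
Hypothesis tau0 : 0 < tau.
Hypothesis A01 : GRing.comm A0 A1.

Local Notation A2 := (A1 * op_exp (- (tau%:C *: A0))).
Local Notation E t := (op_exp (t%:C *: A0)).
Local Notation D := (delayed_exp tau A2).

Let A2E : A2 = A1 * E (- tau).
Proof. by rewrite rmorphN scaleNr. Qed.

Let E_A1 t : GRing.comm A1 (E t).
Proof. by apply: comm_op_exp; apply: commr_op_scale; exact: commr_sym. Qed.

Let E_add s t : E (s + t) = E s * E t.
Proof. exact: op_exp_add. Qed.

Let E_A2 t : GRing.comm (E t) A2.
Proof.
rewrite A2E; apply: commrM; first by apply: commr_sym.
by rewrite /GRing.comm -!E_add addrC.
Qed.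

Lemma comm_exp_delayed_exp t : E t * D t = D t * E t.
Proof.
rewrite /delayed_exp; case: ifP => _; first by rewrite mulr0 mul0r.
case: ifP => _; first by rewrite mulr1 mul1r.
by apply: commr_sum => l _; apply: commr_op_scale; exact: commrX.
Qed.

Definition delayed_solution t := E t * D t.
Local Notation S0 := delayed_solution.

Lemma delayed_solution_history t : t < 0 -> S0 t = 0.
Proof. by move=> t0; rewrite /delayed_solution /delayed_exp t0 mulr0. Qed.

Lemma delayed_solution0 : S0 0 = 1.
Proof.
by rewrite /delayed_solution /delayed_exp ltxx eqxx mulr1 scale0r op_exp0.
Qed.

Let dS0 n t (F : set_system R) {FF : Filter F} : F `=>` t^' ->
  derivative_along F D t (A2 * delayed_poly tau A2 n (t - tau)) ->
  derivative_along F S0 t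
    (A0 * S0 t + A1 * (E (t - tau) * delayed_poly tau A2 n (t - tau))).
Proof.
move=> Ft dD.
have -> : A1 * (E (t - tau) * delayed_poly tau A2 n (t - tau)) =
    E t * (A2 * delayed_poly tau A2 n (t - tau)).
  have -> : E (t - tau) = E (- tau) * E t by rewrite -E_add addrC.
  by rewrite [RHS]mulrA E_A2 A2E !mulrA.
rewrite [S0 t]/delayed_solution [A0 * _]mulrA.
exact: (derivative_alongM Ft (@op_exp_one_sided_derivative A0 _ _ Ft) dD).
Qed.

Let dS0_shift n t (F : set_system R) {FF : Filter F} : F `=>` t^' ->
  n%:R * tau <= t <= n.+1%:R * tau -> (n == 0)%N ==> (t != tau) ->
  derivative_along F D t (A2 * delayed_poly tau A2 n (t - tau)) ->
  derivative_along F S0 t (A0 * S0 t + A1 * S0 (t - tau)).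
Proof.
move=> Ft nt nt' dD; rewrite [S0 (t - tau)]/delayed_solution.
by rewrite (delayed_exp_poly_shift _ tau0 nt nt'); exact: dS0.
Qed.

Lemma exists_step_right t : 0 <= t -> exists n, n%:R * tau <= t < n.+1%:R * tau.
Proof.
move=> t0; exists (Num.truncn (t / tau)).
have := Num.Theory.truncn_itv (divr_ge0 t0 (ltW tau0)).
by rewrite ler_pdivlMr // ltr_pdivrMr.
Qed.

Lemma exists_step_left t : 0 < t -> exists n, n%:R * tau < t <= n.+1%:R * tau.
Proof.
move=> t0; have [[|n]] := exists_step_right (ltW t0).
  by rewrite mul0r => /andP[_ t1]; exists 0%N; rewrite mul0r t0 ltW.
rewrite le_eqVlt => /andP[/orP[/eqP<- _|nt tn]].
  by exists n; rewrite lexx andbT ltr_pM2r // ltr_nat.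
by exists n.+1; rewrite nt ltW.
Qed.

Let S0_cvg_right t : 0 <= t -> S0 s @[s --> t^'+] --> S0 t.
Proof.
move=> /exists_step_right[n nt].
have FF : Filter t^'+ by exact: at_right_proper_filter.
have Ft := @at_right_dnbhs _ t.
have dD := @delayed_exp_right_derivative _ _ tau A2 tau0 n t nt.
exact: (derivative_along_cvg Ft (@dS0 n t _ FF Ft dD)).
Qed.

Let S0_cvg_left t : 0 < t -> S0 s @[s --> t^'-] --> S0 t.
Proof.
move=> /exists_step_left[n nt].
have FF : Filter t^'- by exact: at_left_proper_filter.
have Ft := @at_left_dnbhs _ t.
have dD := @delayed_exp_left_derivative _ _ tau A2 tau0 n t nt.
exact: (derivative_along_cvg Ft (@dS0 n t _ FF Ft dD)).
Qed.

Lemma delayed_solution_fundamental (T : R) : 0 < T ->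
  fundamental_solution tau T A0 A1 S0.
Proof.
move=> T0; split.
- by move=> t /andP[_]; exact: delayed_solution_history.
- exact: delayed_solution0.
- apply/continuous_within_itvP => //; split.
  + move=> t /itvP tT; apply/left_right_continuousP.
    by split; [apply: S0_cvg_left|apply: S0_cvg_right]; rewrite tT.
  + exact: S0_cvg_right.
  + exact: S0_cvg_left.
- move=> t /andP[t0 _]; have [n nt] := exists_step_right t0.
  have FF : Filter t^'+ by exact: at_right_proper_filter.
  apply: (@dS0_shift n); first exact: at_right_dnbhs.
  + by case/andP: nt => -> /ltW.
  + apply/implyP => /eqP n0; move: nt; rewrite n0 mul1r => /andP[_ tn].
    by rewrite lt_eqF.
  + exact: delayed_exp_right_derivative.
- move=> t /andP[t0 _] t_ne; have [n nt] := exists_step_left t0.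
  have FF : Filter t^'- by exact: at_left_proper_filter.
  apply: (@dS0_shift n); first exact: at_left_dnbhs.
  + by case/andP: nt => /ltW ->.
  + by rewrite t_ne implybT.
  + exact: delayed_exp_left_derivative.
Qed.

Lemma fundamental_solution_unique (N : nat) (S : R -> bounded_op X) :
  let T := N.+1%:R * tau in
  fundamental_solution tau T A0 A1 S ->
  forall t, - tau <= t <= T -> S t = S0 t.
Proof.
move=> T fS; have T0 : 0 < T by rewrite mulr_gt0.
have fS0 := delayed_solution_fundamental T0.
suff step n : (n <= N.+1)%N ->
    forall t, - tau <= t <= n%:R * tau -> S t = S0 t by exact: step.
elim: n => [_|n IH nN] t.
  rewrite mul0r => /andP[tt]; rewrite le_eqVlt => /orP[/eqP->|t0].
    by rewrite (fundsol_init fS) delayed_solution0.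
  by rewrite (fundsol_history fS) ?tt // delayed_solution_history.
move=> /andP[tt tn]; have [tn'|nt] := leP t (n%:R * tau).
  by apply: IH (ltnW nN) _ _; rewrite tt.
pose a := n%:R * tau; pose b := n.+1%:R * tau.
have a0 : 0 <= a by rewrite mulr_ge0 // ltW.
have bT : b <= T by rewrite ler_pM2r // ler_nat.
have ab : a < b by rewrite ltr_pM2r // ltr_nat.
have abT : `[a, b]%classic `<=` `[0, T]%classic.
  by apply: subset_itv; rewrite bnd_simp.
pose W s := S s - S0 s.
pose E' s := op_exp (s%:C *: - A0).
pose V s := E' s * W s.
have W0 s : - tau <= s <= a -> W s = 0.
  by move=> sa; rewrite /W (IH (ltnW nN) _ sa) subrr.
have cV : {within `[a, b], continuous V}.
  have cE : {within `[a, b], continuous E'}.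
    exact/continuous_subspaceT/op_exp_continuous.
  have cS := continuous_subspaceW abT (fundsol_continuous fS).
  have cS0 := continuous_subspaceW abT (fundsol_continuous fS0).
  move=> x; apply: cvg_opM; first exact: cE.
  by apply: cvgB; [exact: cS|exact: cS0].
have dV s : a <= s < b -> derivative_along s^'+ V s 0.
  move=> /andP[as_ sb].
  have sT : 0 <= s < T by rewrite (le_trans a0 as_) (lt_le_trans sb bT).
  have FF : Filter s^'+ by exact: at_right_proper_filter.
  have Fs := @at_right_dnbhs _ s.
  have dW : derivative_along s^'+ W s (A0 * W s).
    have := derivative_alongB (fundsol_right fS sT) (fundsol_right fS0 sT).
    have -> : S (s - tau) = S0 (s - tau).
      apply: IH (ltnW nN) _ _; rewrite lerBrDl subrr (le_trans a0) //=.
      by rewrite lerBlDr -{2}[tau]mul1r -mulrDl natr1 ltW.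
    by rewrite opprD addrACA subrr addr0 -mulrBr; exact.
  have := derivative_alongM Fs (@op_exp_one_sided_derivative (- A0) _ _ Fs) dW.
  have EA0 : E' s * A0 = A0 * E' s.
    by apply/esym/comm_op_exp/commr_op_scale/commrN.
  by rewrite -/(E' s) [E' s * _]mulrA EA0 mulNr mulNr addNr; exact.
have Va : V a = 0.
  by rewrite /V W0 ?mulr0 // lexx andbT (le_trans _ a0) // oppr_le0 ltW.
have : V t = V a.
  by apply: (zero_right_derivative_constant ab cV dV); rewrite ltW.
rewrite Va => Vt; apply/eqP; rewrite -subr_eq0 -/(W t); apply/eqP.
by rewrite -[W t]mul1r -(op_exp_mulN A0 t) -mulrA -/(V t) Vt mulr0.
Qed.

End Solution.

Theorem theorem31 (R : realType) (X : completeNormedModType R[i])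
    (tau : R) (N : nat) (A0 A1 : bounded_op X) :
  0 < tau ->
  A0 * A1 - A1 * A0 = 0 ->
  let T := N.+1%:R * tau in
  let A2 := A1 * op_exp (- (tau%:C *: A0)) in
  (exists S : R -> bounded_op X, fundamental_solution tau T A0 A1 S) /\
  (forall S : R -> bounded_op X, fundamental_solution tau T A0 A1 S ->
     forall (n : nat) (t : R), (n <= N)%N ->
       n%:R * tau < t <= n.+1%:R * tau ->
       S t = op_exp (t%:C *: A0) * delayed_exp tau A2 t /\
       S t = delayed_exp tau A2 t * op_exp (t%:C *: A0)).
Proof.
move=> tau0 /eqP; rewrite subr_eq0 => /eqP A01 T A2.
split.
  exists (delayed_solution tau A0 A1).
  by apply: delayed_solution_fundamental; rewrite ?mulr_gt0.
move=> S fS n t nN /andP[nt tn].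
rewrite (fundamental_solution_unique tau0 A01 fS); last first.
  rewrite (le_trans tn) ?ler_pM2r ?ler_nat // andbT ltW //.
  rewrite (le_lt_trans _ nt) //.
  by rewrite (@le_trans _ _ 0) ?oppr_le0 ?mulr_ge0 // ltW.
by split => //; rewrite -comm_exp_delayed_exp.
Qed.
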